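(* Let $G$ and $H$ be two finite simple digraphs with $\Delta^+(G)\geq 1$ and $\Delta^+(H)\geq 1$. Then (i) $\gamma_I(G\rightarrow H)=\gamma_I(G)$, and (ii) $r_I(G\rightarrow H)=r_I(G)$.
   Context: For vertex-disjoint digraphs $G$ and $H$, $G\rightarrow H$ is the digraph consisting of $G$ and $H$ together with extra arcs from each vertex of $G$ to every vertex of $H$. $\Delta^+$ denotes maximum out-degree. An Italian dominating function (IDF) on a digraph $D$ is a function $f:V(D)\to\{0,1,2\}$ such that every vertex $v$ with $f(v)=0$ has at least two in-neighbors $w$ with $f(w)=1$ or at least one in-neighbor $w$ with $f(w)=2$; its weight is $\sum_u f(u)$ and $\gamma_I(D)$ is the minimum weight of an IDF. For a set $R$ of arcs not in $A(D)$ (between distinct vertices), $D+R$ is $D$ with these arcs added; $R$ is an Italian reinforcement set if $\gamma_I(D+R)<\gamma_I(D)$. The Italian reinforcement number $r_I(D)$ is the minimum size of such a set, defined to be $0$ if $\gamma_I(D)\leq 2$. *)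

(* Defs.v *)
From mathcomp Require Import all_boot.

Set Implicit Arguments.
Unset Strict Implicit.
Unset Printing Implicit Defensive.

(* A finite simple digraph is an irreflexive relation on a finType, [e x y]
   meaning that there is an arc from x to y; opposite arcs may coexist. *)

Section Digraph.

Variable V : finType.
Implicit Types (e : rel V) (f : {ffun V -> 'I_3}) (R : {set V * V}).

Definition out_degree e (v : V) : nat := #|[set w | e v w]|.

Definition max_out_degree e : nat := \max_(v : V) out_degree e v.

Definition is_IDF e f : bool :=
  [forall v, (f v == 0 :> nat) ==>
     (2 <= #|[set w | e w v & f w == 1 :> nat]|)
     || [exists w, e w v && (f w == 2 :> nat)]].

Definition weight f : nat := \sum_(v : V) f v.

Definition cst2 : {ffun V -> 'I_3} := [ffun=> ord_max].

Lemma cst2_IDF e : is_IDF e cst2.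
Proof. by apply/forallP => v; rewrite ffunE. Qed.

(* By [cst2_IDF] the minimum ranges over a nonempty set. *)
Definition italian_domination_number e : nat :=
  weight [arg min_(f < cst2 | is_IDF e f) weight f].

Definition nonarcs e : {set V * V} :=
  [set p | (p.1 != p.2) && ~~ e p.1 p.2].

Definition add_arcs e R : rel V := [rel x y | e x y || ((x, y) \in R)].

Definition is_reinforcement_set e R : bool :=
  (R \subset nonarcs e) &&
  (italian_domination_number (add_arcs e R) < italian_domination_number e).

(* By [nonarcs_reinforcement] below, the minimum ranges over a nonempty set
   whenever the Italian domination number exceeds 2. *)
Definition italian_reinforcement_number e : nat :=
  if italian_domination_number e <= 2 then 0
  else #|[arg min_(R < nonarcs e | is_reinforcement_set e R) #|R|]|.

Lemma italian_domination_number_min e f :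
  is_IDF e f -> italian_domination_number e <= weight f.
Proof.
rewrite /italian_domination_number => Hf.
by case: arg_minnP => [|g _]; [exact: cst2_IDF | exact].
Qed.

Lemma nonarcs_reinforcement e :
  2 < italian_domination_number e -> is_reinforcement_set e (nonarcs e).
Proof.
move=> gt2; rewrite /is_reinforcement_set subxx /=.
apply: leq_ltn_trans gt2.
case: (pickP (@predT V)) => [u _ | V0]; last first.
  apply: leq_trans (italian_domination_number_min (cst2_IDF _)) _.
  by rewrite /weight big_pred0 // => v; have := V0 v.
pose f : {ffun V -> 'I_3} := [ffun v => if v == u then ord_max else ord0].
have Hf : is_IDF (add_arcs e (nonarcs e)) f.
  apply/forallP => v; apply/implyP; rewrite ffunE.
  case: (eqVneq v u) => // neq_vu _; apply/orP; right; apply/existsP; exists u.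
  apply/andP; split; last by rewrite ffunE eqxx.
  have -> : add_arcs e (nonarcs e) u v = e u v || ((u, v) \in nonarcs e) by [].
  by rewrite inE /= eq_sym neq_vu orbN.
apply: leq_trans (italian_domination_number_min Hf) _.
rewrite /weight (bigD1 u) //= ffunE eqxx big1 // => v neq_vu.
by rewrite ffunE (negPf neq_vu).
Qed.

End Digraph.

(* The digraph G -> H on the disjoint union of the vertex sets. *)
Definition digraph_join (V W : finType) (eG : rel V) (eH : rel W) :
    rel (V + W)%type :=
  fun x y => match x, y with
  | inl a, inl b => eG a b
  | inl _, inr _ => true
  | inr _, inl _ => false
  | inr c, inr d => eH c d
  end.

(* Main.v *)
Require Import Defs.
From mathcomp Require Import all_boot.

(** An IDF of [G] with weight at least 2 extends by zero to [G -> H], since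
    [V(G)] dominates [V(H)].  Conversely, let [f] be an IDF of [(G -> H) + R]
    of weight less than [|V(G)|] (otherwise the constant function 1 on [G] does
    at least as well).  Then [f] has at least as many zeros in [G] as positive
    vertices in [H], so there is a retraction of [V(G) + V(H)] onto [V(G)] that
    is injective on the support of [f].  Pushing [f] and [R] forward along it
    gives an IDF of the same weight on [G] with at most [|R|] added arcs. *)

Set Implicit Arguments.
Unset Strict Implicit.
Unset Printing Implicit Defensive.

Section ItalianDomination.

Variable V : finType.
Implicit Types (e : rel V) (f : {ffun V -> 'I_3}) (R : {set V * V}).

(** Values are at most 2, so in-neighbours with total weight at least 2 include either one of value
    2 or two of value 1. In this additive form the condition can be transported by rearranging
    sums. *)
Lemma is_IDFP e f :
  reflect (forall v, f v = 0 :> nat -> 2 <= \sum_(w | e w v) f w) (is_IDF e f).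
Proof.
apply: (iffP forallP) => [idf v fv0 | dom v].
  have /orP[ge2 | /existsP[w /andP[ewv /eqP fw2]]] := implyP (idf v) (introT eqP fv0).
    apply: leq_trans ge2 _.
    rewrite cardsE -sum1_card big_mkcondr /=.
    by apply: leq_sum => w _; case: eqP => // ->.
  by rewrite (bigD1 w) //= fw2 leq_addr.
apply/implyP => /eqP /dom sum2.
case: (boolP [exists w, _]) => [_ | /existsPn no2]; first by rewrite orbT.
rewrite orbF; apply: leq_trans sum2 _.
rewrite cardsE -sum1_card [leqRHS]big_mkcondr /=.
apply: leq_sum => w ewv; have := no2 w; rewrite ewv /=.
by case: (f w) => [[|[|[|]]]].
Qed.

Lemma is_IDF_sub e e' f : subrel e e' -> is_IDF e f -> is_IDF e' f.
Proof.
move=> see' /is_IDFP idf; apply/is_IDFP => v /idf /leq_trans; apply.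
rewrite big_mkcond [leqRHS]big_mkcond /=; apply: leq_sum => w _.
by case: ifP => // /see' ->.
Qed.

Lemma italian_domination_number_attained e :
  exists2 f, is_IDF e f & weight f = italian_domination_number e.
Proof.
rewrite /italian_domination_number.
by case: arg_minnP => [|f idf _]; [exact: cst2_IDF | exists f].
Qed.

Lemma italian_domination_number_sub e e' :
  subrel e e' -> italian_domination_number e' <= italian_domination_number e.
Proof.
move=> see'; have [f idf <-] := italian_domination_number_attained e.
exact/italian_domination_number_min/(is_IDF_sub see').
Qed.

Lemma italian_domination_number_le_card e : italian_domination_number e <= #|V|.
Proof.
pose f : {ffun V -> 'I_3} := [ffun=> Ordinal (isT : 1 < 3)].
have idf : is_IDF e f by apply/is_IDFP => v; rewrite ffunE.
apply: leq_trans (italian_domination_number_min idf) _.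
by rewrite /weight -sum1_card; apply: leq_sum => v _; rewrite ffunE.
Qed.

(** The in-neighbours of a zero already carry weight 2; without zeros the weight is at least the
    number of vertices. *)
Lemma weight_IDF_ge2 e f : 1 < #|V| -> is_IDF e f -> 1 < weight f.
Proof.
move=> V2 /is_IDFP idf; case: (pickP (fun v => f v == 0 :> nat)) => [v /eqP /idf | pos].
  move/leq_trans; apply; rewrite big_mkcond /=.
  by apply: leq_sum => w _; case: ifP.
apply: leq_trans V2 _; rewrite -sum1_card.
by apply: leq_sum => v _; rewrite lt0n pos.
Qed.

Lemma card_gt1_max_out_degree e :
  irreflexive e -> 0 < max_out_degree e -> 1 < #|V|.
Proof.
move=> irr; rewrite ltnNge => /negP deg; rewrite ltnNge; apply/negP => V1.
apply: deg; apply/bigmax_leqP => v _.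
rewrite leqn0 cards_eq0; apply/eqP/setP => w; rewrite !inE.
by rewrite (fintype_le1P V1 w v) irr.
Qed.

Lemma italian_reinforcement_number_min e R :
  is_reinforcement_set e R -> italian_reinforcement_number e <= #|R|.
Proof.
rewrite /italian_reinforcement_number => HR.
case: (leqP _ 2) => // gt2.
by case: (arg_minnP (fun S : {set V * V} => #|S|) (nonarcs_reinforcement gt2)) => S _; apply.
Qed.

Lemma italian_reinforcement_number_attained e :
  2 < italian_domination_number e ->
  exists2 R, is_reinforcement_set e R & #|R| = italian_reinforcement_number e.
Proof.
move=> gt2; rewrite /italian_reinforcement_number leqNgt gt2 /=.
case: (arg_minnP (fun R : {set V * V} => #|R|) (nonarcs_reinforcement gt2)) => R HR _.
by exists R.
Qed.

End ItalianDomination.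

Section Pushforward.

Variables (U V : finType) (rho : U -> V) (f : {ffun U -> 'I_3}).
Hypothesis rho_inj : {in [pred x | 0 < f x] &, injective rho}.

(** [inord] never truncates here: by [rho_inj] each fibre has at most one positive vertex, so the
    fibre sum stays below 3. *)
Definition pushforward : {ffun V -> 'I_3} :=
  [ffun u => inord (\sum_(x | rho x == u) f x)].

Lemma pushforwardE u : pushforward u = \sum_(x | rho x == u) f x :> nat.
Proof.
rewrite ffunE inordK //.
case: (pickP (fun x => (rho x == u) && (0 < f x))) => [x /andP[/eqP rx fx] | none].
  rewrite (bigD1 x) /=; last by rewrite rx.
  rewrite big1 ?addn0 ?ltn_ord // => y /andP[/eqP ry yx].
  apply/eqP; rewrite -leqn0 leqNgt; apply: contra yx => fy.
  by rewrite (rho_inj fy fx) // rx.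
rewrite big1 // => x rx; apply/eqP; rewrite -leqn0 leqNgt.
by apply/negP => fx; have := none x; rewrite rx fx.
Qed.

Lemma sum_pushforward (P : pred V) :
  \sum_(u | P u) pushforward u = \sum_(x | P (rho x)) f x.
Proof.
rewrite (partition_big rho P) //=; apply: eq_bigr => u Pu.
rewrite pushforwardE; apply: eq_bigl => x.
by case: eqP => [->|]; rewrite ?Pu ?andbF.
Qed.

Lemma weight_pushforward : weight pushforward = weight f.
Proof. exact: (sum_pushforward predT). Qed.

End Pushforward.

Section Join.

Variables (V W : finType).
Implicit Types (G : rel V) (H : rel W) (f : {ffun V + W -> 'I_3}).

Lemma support_retraction f :
  weight f < #|V| ->
  exists2 rho : V + W -> V,
    forall a, rho (inl a) = a & {in [pred x | 0 < f x] &, injective rho}.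
Proof.
move=> ltfV; pose Z := [set a | f (inl a) == 0 :> nat].
pose P := [set c | 0 < f (inr c)].
have wE : weight f = \sum_a f (inl a) + \sum_c f (inr c) by rewrite /weight big_sumType.
have cZ : #|~: Z| <= \sum_a f (inl a).
  rewrite -sum1_card big_mkcond; apply: leq_sum => a _.
  by rewrite !inE -lt0n; case: ifP.
have cP : #|P| <= \sum_c f (inr c).
  rewrite -sum1_card big_mkcond; apply: leq_sum => c _.
  by rewrite !inE; case: ifP.
(* Add the size of the complement of [Z] to both sides: the left is then at most [weight f], the
   right is [#|V|]. *)
have lePZ : #|P| <= #|Z|.
  rewrite -(leq_add2r #|~: Z|) cardsC; apply: leq_trans (ltnW ltfV).
  by rewrite wE addnC leq_add.
have [a0 _] : exists a0 : V, true.
  by apply/existsP; rewrite -[X in is_true X]negbK; apply/negP => /existsPn none;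
     move: ltfV; rewrite eq_card0 // => a; have := none a.
(* [phi] sends the i-th element of [P] to the i-th element of [Z]. Its values outside [P] are
   arbitrary, since injectivity is required only on the support. *)
pose phi c := nth a0 (enum Z) (index c (enum P)).
have idxZ c : c \in P -> index c (enum P) < size (enum Z).
  by move=> cinP; rewrite -cardE (leq_trans _ lePZ) // cardE index_mem mem_enum.
have phiZ c : c \in P -> f (inl (phi c)) = 0 :> nat.
  move=> cinP; have : phi c \in enum Z by rewrite mem_nth ?idxZ.
  by rewrite mem_enum inE => /eqP.
exists (fun x => match x with inl a => a | inr c => phi c end) => //.
move=> [a|c] [b|d]; rewrite !inE => fx fy.
- by move=> ->.
- by move=> ab; move: fx; rewrite ab phiZ // inE.
- by move=> ab; move: fy; rewrite -ab phiZ // inE.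
- move=> /eqP; rewrite nth_uniq ?enum_uniq ?idxZ ?inE // => /eqP eqi.
  congr inr; rewrite -(nth_index c (s := enum P) (x := c)) ?mem_enum ?inE //.
  by rewrite eqi nth_index // mem_enum inE.
Qed.

Lemma italian_domination_number_join_le G H :
  1 < #|V| ->
  italian_domination_number (digraph_join G H) <= italian_domination_number G.
Proof.
move=> V2; have [g idg <-] := italian_domination_number_attained G.
pose f : {ffun V + W -> 'I_3} := [ffun x => if x is inl a then g a else ord0].
have fl a : f (inl a) = g a by rewrite ffunE.
have sumE (P : pred (V + W)) : \sum_(x | P x) f x = \sum_(a | P (inl a)) g a.
  rewrite big_sumType /= [X in _ + X]big1 => [|c _]; last by rewrite ffunE.
  by rewrite addn0; apply: eq_bigr => a _; rewrite fl.
suff idf : is_IDF (digraph_join G H) f.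
  apply: leq_trans (italian_domination_number_min idf) _.
  by rewrite /weight sumE.
(* A vertex of [H] has all of [G] as in-neighbours, so it receives the whole weight of [g]. *)
apply/is_IDFP => -[v | c]; rewrite sumE /=; last by move=> _; apply: weight_IDF_ge2 idg.
by rewrite fl; apply: (is_IDFP _ _ idg).
Qed.

(** Serves both claims: with [R] empty it gives the lower bound on the domination number of the
    join, and with [R] a minimum reinforcement set of the join it yields one of [G] that is no
    larger. *)
Lemma italian_domination_number_fold G H (R : {set (V + W) * (V + W)}) :
  exists R' : {set V * V}, [/\ R' \subset nonarcs G, #|R'| <= #|R| &
    italian_domination_number (add_arcs G R') <=
    italian_domination_number (add_arcs (digraph_join G H) R)].
Proof.
have [f idf wf] := italian_domination_number_attained (add_arcs (digraph_join G H) R).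
rewrite -wf; case: (leqP #|V| (weight f)) => [leVf | ltfV].
  exists set0; split; rewrite ?sub0set ?cards0 //.
  exact: leq_trans (italian_domination_number_le_card _) leVf.
have [rho rhoK rho_inj] := support_retraction ltfV.
(* The intersection drops images that are loops or already arcs of [G]. *)
pose R' := [set (rho p.1, rho p.2) | p in R] :&: nonarcs G.
exists R'; split; first exact: subsetIr.
  by rewrite (leq_trans (subset_leq_card (subsetIl _ _))) ?leq_imset_card.
rewrite -(weight_pushforward rho_inj); apply: italian_domination_number_min.
apply/is_IDFP => v fv0; rewrite sum_pushforward //.
have null x : rho x = v -> f x = 0 :> nat.
  move=> rx; apply/eqP; rewrite -leqn0 -[leqRHS]fv0 pushforwardE //.
  by rewrite (bigD1 x) ?rx //= leq_addr.
apply: leq_trans (is_IDFP _ _ idf (inl v) (null _ (rhoK v))) _.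
rewrite big_mkcond [leqRHS]big_mkcond; apply: leq_sum => x _.
(* Termwise, it suffices that [rho] maps each positive in-neighbour of [inl v] to an in-neighbour of
   [v]. A join arc into [inl v] starts in [G], where [rho] is the identity; the other arcs come from
   [R]. *)
case: ifP => // xv; case: ifP => //; apply: contraFT; rewrite -ltnNge => fx.
have {xv} /orP[Jxv | Rxv] := xv.
  by case: x Jxv fx => //= a Gav _; rewrite rhoK /add_arcs /= Gav.
rewrite /add_arcs /=; case: (boolP (G _ _)) => //= nG.
rewrite inE [_ \in nonarcs _]inE /= nG andbT.
(* The image is no loop: [f] vanishes on the fibre over [v], but is positive at [x]. *)
apply/andP; split; last by apply: contraTneq fx => /null ->.
by apply/imsetP; exists (x, inl v); rewrite //= rhoK.
Qed.

Lemma italian_domination_number_join G H :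
  1 < #|V| ->
  italian_domination_number (digraph_join G H) = italian_domination_number G.
Proof.
move=> V2; apply/eqP; rewrite eqn_leq italian_domination_number_join_le //=.
have [R' [_ ]] := italian_domination_number_fold G H set0.
rewrite cards0 leqn0 cards_eq0 => /eqP -> le0.
have subG : subrel (add_arcs G set0) G by move=> x y; rewrite /add_arcs /= inE orbF.
have subJ : subrel (digraph_join G H) (add_arcs (digraph_join G H) set0).
  by move=> x y; rewrite /add_arcs /= => ->.
apply: leq_trans (italian_domination_number_sub subG) _.
exact: leq_trans le0 (italian_domination_number_sub subJ).
Qed.

Lemma reinforcement_set_join G H (R : {set V * V}) :
  1 < #|V| -> is_reinforcement_set G R ->
  is_reinforcement_set (digraph_join G H)
    [set (inl p.1 : V + W, inl p.2 : V + W) | p in R].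
Proof.
move=> V2 /andP[sR ltR]; apply/andP; split.
  apply/subsetP => _ /imsetP[p /(subsetP sR) + ->]; rewrite !inE /=.
  by rewrite (inj_eq (@inl_inj _ _)).
rewrite italian_domination_number_join //; apply: leq_ltn_trans ltR.
apply: leq_trans (italian_domination_number_join_le (add_arcs G R) H V2).
(* Adding [R] to [G] before joining creates no arcs beyond those of the join with the image of [R]
   added. *)
apply: italian_domination_number_sub => -[a|c] [b|d] //=; rewrite /add_arcs /=; last by move->.
case/orP => [-> // | Rab]; apply/orP; right.
by apply/imsetP; exists (a, b).
Qed.

End Join.

Theorem theorem4p6 (V W : finType) (G : rel V) (H : rel W)
  (irrG : irreflexive G) (irrH : irreflexive H)
  (dG : 1 <= max_out_degree G) (dH : 1 <= max_out_degree H) :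
  italian_domination_number (digraph_join G H) = italian_domination_number G
  /\ italian_reinforcement_number (digraph_join G H) =
     italian_reinforcement_number G.
Proof.
have V2 := card_gt1_max_out_degree irrG dG.
have gJ := italian_domination_number_join G H V2.
split=> //; case: (leqP (italian_domination_number G) 2) => [le2 | gt2].
  by rewrite /italian_reinforcement_number gJ le2.
apply/eqP; rewrite eqn_leq; apply/andP; split.
  have [R HR <-] := italian_reinforcement_number_attained gt2.
  apply: leq_trans (leq_imset_card _ _).
  exact/italian_reinforcement_number_min/(reinforcement_set_join H V2 HR).
have [|R /andP[_ ltR] <-] := @italian_reinforcement_number_attained _ (digraph_join G H).
  by rewrite gJ.
(* The folded set still reinforces [G], because the join and [G] have the same domination number. *)
have [R' [sR' leR' leg]] := italian_domination_number_fold G H R.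
apply: leq_trans leR'; apply: italian_reinforcement_number_min.
by rewrite /is_reinforcement_set sR' (leq_ltn_trans leg) // -gJ.
Qed.
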